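(* Let $d\ge 2$ be an integer, let $0<\varepsilon<1/2$, and let $G$ be an $(n,D,\lambda)$-graph with $\lambda>0$ such that $$\frac{D}{\lambda} \;\ge\; \frac{160\, d^{5/2}\log (2/\varepsilon)}{\varepsilon}.$$ Then $G$ contains a copy (as a not necessarily induced subgraph) of every tree $T$ with $\lfloor(1-\varepsilon)n\rfloor$ vertices and with maximum degree at most $d$.
   Context: For a finite simple graph $G$ on $n$ vertices let $\lambda_1\ge\lambda_2\ge\cdots\ge\lambda_n$ be the eigenvalues of its adjacency matrix. The second eigenvalue of $G$ is $\lambda(G)=\max_{i\ge 2}|\lambda_i|$. A graph $G$ is called an $(n,D,\lambda)$-graph if it is $D$-regular, has $n$ vertices, and $\lambda(G)\le\lambda$. $\log$ is the natural logarithm. *)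

(* Defs.v *)
From HB Require Import structures.
From mathcomp Require Import all_boot all_order all_algebra.
From mathcomp Require Import polyrcf.
From mathcomp Require Import all_classical all_reals all_analysis.

Set Implicit Arguments.
Unset Strict Implicit.
Unset Printing Implicit Defensive.

Import Order.TTheory GRing.Theory Num.Theory.

Local Open Scope ring_scope.

Record sgraph := SGraph {
  vertex :> finType;
  edge : rel vertex;
  edge_sym : symmetric edge;
  edge_irrefl : irreflexive edge }.

Definition degree (G : sgraph) (x : G) : nat := #|[pred y | edge x y]|.

Definition regular (G : sgraph) (D : nat) : Prop :=
  forall x : G, degree x = D.

Definition max_degree (G : sgraph) : nat :=
  (\max_(x : G) degree x)%N.

Definition connected_graph (G : sgraph) : Prop :=
  (0 < #|G|)%N /\ forall x y : G, connect (@edge G) x y.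

(* ucycle also accepts cyclic sequences of size at most 2 (such as x, y for
   an edge xy), which are not cycles of the graph. *)
Definition acyclic_graph (G : sgraph) : Prop :=
  forall c : seq G, ucycle (@edge G) c -> (size c <= 2)%N.

Definition tree (G : sgraph) : Prop := connected_graph G /\ acyclic_graph G.

Definition contains_copy (G H : sgraph) : Prop :=
  exists f : H -> G,
    injective f /\ forall x y : H, edge x y -> edge (f x) (f y).

Definition adjmx (R : realType) (G : sgraph) : 'M[R]_#|G| :=
  \matrix_(i, j) (edge (enum_val i) (enum_val j))%:R.

(* The real eigenvalues in nonincreasing order, each repeated according to its
   algebraic multiplicity: mup x p is the multiplicity of the root x of p, and
   rootsR lists the distinct real roots of p in increasing order. *)
Definition eigenvalues (R : realType) (n : nat) (A : 'M[R]_n) : seq R :=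
  let p := char_poly A in
  rev (flatten [seq nseq (mup x p) x | x <- rootsR p]).

(* Indices start at 0, so lambda_2, ..., lambda_n are the entries
   1, ..., #|G|.-1; the value is 0 when #|G| <= 1. *)
Definition second_eigenvalue (R : realType) (G : sgraph) : R :=
  \big[Num.max/0]_(1 <= i < #|G|) `|(eigenvalues (adjmx R G))`_i|.

Definition ndl_graph (R : realType) (n D : nat) (lambda : R) (G : sgraph)
    : Prop :=
  [/\ #|G| = n, regular G D & second_eigenvalue R G <= lambda].

(* Main.v *)
Require Import Defs.
From HB Require Import structures.
From mathcomp Require Import all_boot all_order all_algebra.
From mathcomp Require Import spectral polyrcf complex.
From mathcomp Require Import all_classical all_reals all_analysis.
From mathcomp Require Import fintype finset zify ring lra.

(** The tree is embedded vertex by vertex into G, each new vertex being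
    attached to an already embedded neighbour.  A greedy embedding could get
    stuck, so one keeps an invariant due to Friedman and Pippenger: every
    embedded vertex still has to accommodate a certain number of children (its
    demand), every free vertex counts as having demand d, and each set X of at
    most m vertices must have at least as many free neighbours as the total
    demand of X.  Call X critical when this holds with equality.  The number
    of free neighbours is submodular in X and the demand is modular, so
    critical sets are closed under union, provided the union does not become
    too large; following Haxell, this is excluded by asking that sets of size
    between m and 2m expand so much that they cannot be critical while the tree
    is incomplete.  If no free neighbour y of v could host the next child of
    v, each y would lie in the neighbourhood of a critical set avoiding v, and
    the union of these sets together with v would violate the invariant
    ([demand_met_extend]).  This gives [expander_contains_tree]: a
    graph in which nonempty sets X of size at most m have more than d|X|
    neighbours, and those of size between m and 2m at least d|X| + |T|,
    contains T.

    The expansion of an (n, D, lambda)-graph comes from its spectrum.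
    Diagonalising the adjacency matrix over the complex numbers shows that on
    vectors orthogonal to the constants it multiplies norms by at most lambda
    ([norm_off_top_eigenvector]).  Applied to the indicator function of X,
    together with Cauchy-Schwarz on N(X), this is Tanner's inequality
    |N(X)| >= K^2 |X| / (1 + K^2 |X| / n), where K = D / lambda ([tanner]).
    With m about eps n / (4 d), sets of size at most m expand by more than d,
    and a set of more than m vertices has all but at most
    n / K <= eps n / 4 of the vertices as neighbours.  These
    estimates rest on K >= 4 d / eps, which follows from the hypothesis on
    D / lambda. *)

Set Implicit Arguments.
Unset Strict Implicit.
Unset Printing Implicit Defensive.

Import Order.TTheory GRing.Theory Num.Theory.
Local Open Scope ring_scope.

(** * Neighbourhoods and the Friedman-Pippenger invariant *)

Local Open Scope nat_scope.

Definition nbhd (G : sgraph) (X : {set G}) : {set G} :=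
  [set y | [exists x in X, edge x y]].

Lemma nbhdP (G : sgraph) (X : {set G}) (y : G) :
  reflect (exists2 x, x \in X & edge x y) (y \in nbhd X).
Proof. by rewrite inE; apply: exists_inP. Qed.

Lemma nbhdS (G : sgraph) (X Y : {set G}) : X \subset Y -> nbhd X \subset nbhd Y.
Proof.
move=> sXY; apply/subsetP => y /nbhdP[x xX exy]; apply/nbhdP; exists x => //.
exact: (subsetP sXY).
Qed.

Lemma nbhdU (G : sgraph) (X Y : {set G}) : nbhd (X :|: Y) = nbhd X :|: nbhd Y.
Proof.
apply/eqP; rewrite eqEsubset subUset !nbhdS ?subsetUl ?subsetUr // !andbT.
apply/subsetP => y /nbhdP[x]; rewrite !in_setU => /orP[xX|xY] exy.
  by apply/orP; left; apply/nbhdP; exists x.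
by apply/orP; right; apply/nbhdP; exists x.
Qed.

Lemma sum_setUI (I : finType) (F : I -> nat) (A B : {set I}) :
  \sum_(i in A :|: B) F i + \sum_(i in A :&: B) F i =
  \sum_(i in A) F i + \sum_(i in B) F i.
Proof.
rewrite (big_setID B) /= (setIidPr (subsetUr A B)).
have -> : (A :|: B) :\: B = A :\: B by rewrite setDUl setDv setU0.
by rewrite [\sum_(i in A) F i](big_setID B) /=; lia.
Qed.

(** [U] is the set of occupied vertices and [b x] the number of further
    neighbours that [x] may claim.  As in Hall's theorem, the condition asks
    that the claims of every small set be jointly satisfiable by free
    neighbours. *)
Definition demand_met (G : sgraph) (m : nat) (U : {set G}) (b : G -> nat) :=
  forall X : {set G}, #|X| <= m -> \sum_(x in X) b x <= #|nbhd X :\: U|.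

(** Together with [demand_met] this says that the claims of [X] use up its free
    neighbours exactly. *)
Definition critical (G : sgraph) (m : nat) (U : {set G}) (b : G -> nat)
    (X : {set G}) :=
  (#|X| <= m) && (#|nbhd X :\: U| <= \sum_(x in X) b x).

Lemma critical0 (G : sgraph) (m : nat) (U : {set G}) (b : G -> nat) :
  critical m U b set0.
Proof.
rewrite /critical cards0 /= big_set0 leqn0 cards_eq0 -subset0.
by apply/subsetP => y; rewrite in_setD => /andP[_ /nbhdP[x]]; rewrite inE.
Qed.

(** The slack, free neighbours minus demand, is submodular.  Hence the slack of
    the union is at most minus that of the intersection, which is nonnegative
    because the intersection is small.  The strict expansion of medium sets
    then shows that the union is itself small. *)
Lemma criticalU (G : sgraph) (m : nat) (U : {set G}) (b : G -> nat)
    (X Y : {set G}) :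
  demand_met m U b ->
  (forall Z : {set G}, m < #|Z| <= m.*2 ->
     \sum_(z in Z) b z < #|nbhd Z :\: U|) ->
  critical m U b X -> critical m U b Y -> critical m U b (X :|: Y).
Proof.
move=> met med /andP[Xm Xc] /andP[Ym Yc].
have small : #|X :|: Y| <= m.*2.
  by apply: leq_trans (leq_card_setU X Y) _; lia.
have Im : #|X :&: Y| <= m.
  by apply: leq_trans (subset_leq_card (subsetIl X Y)) Xm.
have submod : #|nbhd (X :|: Y) :\: U| + #|nbhd (X :&: Y) :\: U| <=
    #|nbhd X :\: U| + #|nbhd Y :\: U|.
  rewrite nbhdU setDUl -[leqRHS]cardsUI leq_add2l; apply: subset_leq_card.
  by rewrite subsetI !setSD ?nbhdS ?subsetIl ?subsetIr.
have tight : #|nbhd (X :|: Y) :\: U| <= \sum_(x in X :|: Y) b x.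
  have := sum_setUI b X Y; have := met _ Im; lia.
rewrite /critical tight andbT leqNgt; apply/negP => big.
by have := med (X :|: Y); rewrite big small => /(_ isT); lia.
Qed.

(** If occupying a free neighbour [y] of [v] breaks the invariant, then some
    critical set avoiding [v] has [y] in its neighbourhood.  Were this so for
    every [y], the union [W] of all critical sets avoiding [v] would absorb the
    free neighbours of [v]: adding [v] to [W] would raise the demand but not
    the number of free neighbours. *)
Lemma demand_met_extend (G : sgraph) (m : nat) (U : {set G}) (b : G -> nat)
    (v : G) :
  0 < m -> demand_met m U b ->
  (forall Z : {set G}, m < #|Z| <= m.*2 ->
     \sum_(z in Z) b z < #|nbhd Z :\: U|) ->
  0 < b v ->
  exists y, [/\ edge v y, y \notin U &
    demand_met m (y |: U) (fun x => b x - (x == v) - (x == y))].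
Proof.
move=> m0 met med bv.
pose bad X := critical m U b X && (v \notin X).
pose W := \bigcup_(X | bad X) X.
have /andP[Wc vW] : bad W.
  rewrite /W; apply: (big_ind bad) => //.
    by rewrite /bad critical0 inE.
  move=> X Y /andP[Xc vX] /andP[Yc vY].
  by rewrite /bad criticalU // in_setU negb_or vX.
have [sub|] := boolP (nbhd [set v] :\: U \subset nbhd W); last first.
  case/subsetPn => y; rewrite in_setD => /andP[yU /nbhdP[x /set1P -> vy]] yW.
  (* A neighbour of v outside N(W) is a valid choice: a set X violating the
     new invariant would be critical and avoid v, so X would be part of W. *)
  exists y; split=> // X Xm; rewrite leqNgt; apply/negP => lt.
  have cardy : #|nbhd X :\: U| = (y \in nbhd X) + #|nbhd X :\: (y |: U)|.
    rewrite (cardsD1 y) in_setD yU /=; congr (_ + _); apply: eq_card => z.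
    by rewrite !inE negb_or andbA.
  have sumv : \sum_(x in X) (b x - (x == v) - (x == y)) + (v \in X) <=
      \sum_(x in X) b x.
    case: (boolP (v \in X)) => vX; last first.
      by rewrite addn0; apply: leq_sum => z _; lia.
    rewrite (bigD1 v) //= [X in _ <= X](bigD1 v) //= eqxx.
    have : \sum_(i in X | i != v) (b i - (i == v) - (i == y)) <=
      \sum_(i in X | i != v) b i by apply: leq_sum => z _; lia.
    lia.
  have metX := met X Xm.
  have [yX vX] : (y \in nbhd X) /\ (v \notin X) by split; lia.
  have badX : bad X by rewrite /bad /critical Xm vX /= andbT; lia.
  case/negP: yW; move: yX; apply/subsetP/nbhdS.
  exact: bigcup_sup.
(* All free neighbours of v are absorbed by W. *)
case/andP: (Wc) => Wm tight.
have over : #|nbhd (v |: W) :\: U| < \sum_(x in v |: W) b x.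
  rewrite big_setU1 //=.
  have : #|nbhd (v |: W) :\: U| <= #|nbhd W :\: U|.
    apply: subset_leq_card; rewrite nbhdU setDUl subUset subxx andbT.
    by apply/subsetP => y yN; rewrite in_setD (subsetP sub) // andbT;
       move: yN; rewrite in_setD => /andP[].
  lia.
have := cardsU1 v W; rewrite vW add1n => cardv.
case: (leqP #|v |: W| m) => vm.
  by have := met _ vm; lia.
have vm2 : m < #|v |: W| <= m.*2 by rewrite vm /=; lia.
by have := med _ vm2; lia.
Qed.

(** * Growing a copy of a tree *)

Definition induced (T : sgraph) (S : {set T}) : rel T :=
  [rel x y | [&& x \in S, y \in S & edge x y]].

Lemma induced_connect_sym (T : sgraph) (S : {set T}) :
  connect_sym (induced S).
Proof.
by apply: sym_connect_sym => x y; rewrite /induced /= edge_sym andbCA.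
Qed.

Lemma boundary_edge (T : sgraph) (S : {set T}) :
  connected_graph T -> S != set0 -> S != setT ->
  exists s t, [/\ s \in S, t \notin S & edge s t].
Proof.
move=> [_ conn] /set0Pn[r rS] SnT.
have [|] := boolP [exists s in S, exists t in ~: S, edge s t].
  case/exists_inP => s sS /exists_inP[t]; rewrite in_setC => tS est.
  by exists s, t.
rewrite negb_exists_in => /forall_inP nb.
case/negP: SnT; rewrite eqEsubset subsetT /=; apply/subsetP => t _.
have step x y : edge x y -> x \in S -> y \in S.
  move=> exy xS; apply: contraT => yS; case/negP: (nb x xS).
  by apply/exists_inP; exists y; rewrite ?in_setC.
have cl : fingraph.closed (@edge T) S.
  by move=> x y exy; apply/idP/idP; apply: step; rewrite // edge_sym.
by rewrite -(closed_connect cl (conn r t)).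
Qed.

(** Otherwise a path from [s] to [s'] inside [S] closes up to a cycle through
    [t].  This is what makes the step of the embedding easy: the new vertex has
    to be adjacent to a single prescribed vertex. *)
Lemma acyclic_attachment_unique (T : sgraph) (S : {set T}) (r s s' t : T) :
  acyclic_graph T -> {in S, forall x, connect (induced S) r x} ->
  s \in S -> s' \in S -> t \notin S -> edge s t -> edge s' t -> s = s'.
Proof.
move=> acyc conn sS s'S tS est es't.
have /connectP[p0 pth0 last0] : connect (induced S) s s'.
  apply: (@connect_trans _ _ r); last exact: conn.
  by rewrite induced_connect_sym conn.
case: (shortenP pth0) last0 => p pth uniqp _ lastp.
have inS : {subset s :: p <= S}.
  move=> x; rewrite in_cons => /orP[/eqP -> //|xp].
  have : all (mem S) p.
    elim: p (s) pth {uniqp lastp xp} => //= y p IH z.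
    by case/andP => /and3P[_ yS _] /IH ->; rewrite yS.
  by move/allP; apply.
have pthe : path (@edge T) s p.
  by apply: sub_path pth => x y /and3P[].
have cyc : ucycle (@edge T) (t :: s :: p).
  rewrite /ucycle /= rcons_path pthe -lastp es't edge_sym est /=.
  by move: uniqp => /= ->; rewrite andbT; apply: contra tS; apply: inS.
by case: p {pth uniqp inS pthe} lastp cyc => // y p _ /acyc.
Qed.

Lemma card_neighbours_lt (T : sgraph) (S : {set T}) (s t : T) :
  t \notin S -> edge s t -> #|[set x in S | edge s x]| < degree s.
Proof.
move=> tS est; apply: proper_card; apply/properP; split.
  by apply/subsetP => x; rewrite !inE => /andP[].
by exists t; rewrite inE ?(negPf tS).
Qed.

(** The part [S] of the tree, connected to [r], is embedded by [f], and each
    embedded vertex keeps enough demand for its neighbours outside [S].  The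
    values of [f] outside [S] are arbitrary. *)
Definition embeds_part (G T : sgraph) (d m : nat) (r : T) (S : {set T})
    (f : T -> G) (b : G -> nat) : Prop :=
  [/\ {in S, forall x, connect (induced S) r x},
      {in S &, injective f},
      {in S &, forall x y, edge x y -> edge (f x) (f y)},
      demand_met m (f @: S) b &
      [/\ forall v, b v <= d,
          {in S, forall s, d <= b (f s) + #|[set x in S | edge s x]|} &
          forall v, v \notin f @: S -> d <= b v]].

Lemma embeds_part_extend (G T : sgraph) (d m : nat) (r : T) (S : {set T})
    (f : T -> G) (b : G -> nat) :
  0 < m ->
  (forall Z : {set G}, m < #|Z| <= m.*2 -> d * #|Z| + #|T| <= #|nbhd Z|) ->
  tree T -> max_degree T <= d -> r \in S -> S != setT ->
  embeds_part d m r S f b ->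
  exists (t : T) (f' : T -> G) (b' : G -> nat),
    t \notin S /\ embeds_part d m r (t |: S) f' b'.
Proof.
move=> m0 big [connT acycT] degT rS SnT [conn inj hom met [b_le b_in b_out]].
have [|s [t [sS tS est]]] := boundary_edge connT _ SnT.
  by apply/set0Pn; exists r.
have degs : degree s <= d.
  by apply: leq_trans degT; rewrite /max_degree (leq_bigmax s).
have bs : 0 < b (f s).
  have := b_in s sS; have := card_neighbours_lt tS est; lia.
have cardS : #|S| < #|T|.
  by rewrite -cardsT; apply: proper_card; rewrite properT.
(* A medium set has total demand at most d|Z|, and f(S) hides fewer than |T| of
   its neighbours, so it cannot be critical. *)
have [] := @demand_met_extend G m (f @: S) b (f s) m0 met _ bs.
  move=> Z mZ; have := big Z mZ.
  have : \sum_(z in Z) b z <= d * #|Z|.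
    rewrite mulnC -sum_nat_const; exact: leq_sum.
  have : #|nbhd Z| <= #|nbhd Z :\: f @: S| + #|S|.
    rewrite -(cardsID (f @: S) (nbhd Z)) addnC leq_add2l.
    apply: leq_trans (leq_imset_card f S).
    exact/subset_leq_card/subsetIr.
  lia.
move=> y [ey yU met'].
pose f' x := if x == t then y else f x.
have f't : f' t = y by rewrite /f' eqxx.
have f'S x : x \in S -> f' x = f x.
  by rewrite /f'; case: eqP => // -> tS'; rewrite tS' in tS.
have neqy x : x \in S -> f x != y.
  by move=> xS; apply: contraNneq yU => <-; apply: imset_f.
have imf' : f' @: (t |: S) = y |: f @: S.
  by rewrite imsetU1 f't; congr (_ |: _); apply: eq_in_imset.
have uniq_nb x : x \in S -> edge x t -> x = s.
  by move=> xS ext; apply: (acyclic_attachment_unique acycT conn _ _ tS).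
have connt : connect (induced (t |: S)) r s.
  have := conn s sS; apply: connect_sub => u w /and3P[uS wS euw].
  by apply: connect1; rewrite /induced /= !inE uS wS euw !orbT.
exists t, f', (fun x => b x - (x == f s) - (x == y)); split=> //.
split.
- move=> x; rewrite in_setU1 => /orP[/eqP ->|xS].
    apply: connect_trans connt _; apply: connect1.
    by rewrite /induced /= !inE sS eqxx est !orbT.
  have := conn x xS; apply: connect_sub => u w /and3P[uS wS euw].
  by apply: connect1; rewrite /induced /= !inE uS wS euw !orbT.
- move=> x x'; rewrite !in_setU1 => /orP[/eqP ->|xS] /orP[/eqP ->|x'S] //.
  + by rewrite f't f'S // => /esym/eqP; rewrite (negPf (neqy _ x'S)).
  + by rewrite f't f'S // => /eqP; rewrite (negPf (neqy _ xS)).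
  + by rewrite !f'S //; apply: inj.
- move=> x x'; rewrite !in_setU1 => /orP[/eqP ->|xS] /orP[/eqP ->|x'S].
  + by rewrite edge_irrefl.
  + by rewrite f't f'S // edge_sym => /(uniq_nb _ x'S) ->; rewrite edge_sym.
  + by rewrite f't f'S // => /(uniq_nb _ xS) ->.
  + by rewrite !f'S //; apply: hom.
- by rewrite imf'.
split.
- by move=> v; have := b_le v; lia.
- move=> x; rewrite in_setU1 => /orP[/eqP ->|xS].
    rewrite f't eqxx; have := b_out y yU.
    have -> : (y == f s) = false by rewrite eq_sym (negPf (neqy _ sS)).
    have : 0 < #|[set x0 in t |: S | edge t x0]|.
      by apply/card_gt0P; exists s; rewrite !inE sS orbT edge_sym est.
    lia.
  rewrite f'S // (negPf (neqy _ xS)).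
  have mono : [set x0 in S | edge x x0] \subset [set x0 in t |: S | edge x x0].
    by apply/subsetP => z; rewrite !inE => /andP[-> ->]; rewrite orbT.
  have := b_in x xS; case: eqP => [|_]; last first.
    by have := subset_leq_card mono; lia.
  move=> /(inj _ _ xS sS) xs.
  have : #|[set x0 in S | edge x x0]| < #|[set x0 in t |: S | edge x x0]|.
    apply: proper_card; rewrite properE mono /=; apply/subsetPn; exists t.
      by rewrite !inE eqxx xs est.
    by rewrite !inE (negPf tS).
  lia.
- move=> v; rewrite imf' in_setU1 negb_or => /andP[vy vU].
  rewrite (negPf vy).
  have -> : (v == f s) = false.
    by apply: contraNF vU => /eqP ->; apply: imset_f.
  by have := b_out v vU; lia.
Qed.

(** Expansion of the sets of size at most [m] makes the invariant hold for a
    single embedded vertex, which can hide at most one neighbour of a set;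
    that is why the first inequality is strict. *)
Theorem expander_contains_tree (G T : sgraph) (d m : nat) :
  0 < #|G| -> 0 < m ->
  (forall X : {set G}, 0 < #|X| <= m -> d * #|X| < #|nbhd X|) ->
  (forall X : {set G}, m < #|X| <= m.*2 -> d * #|X| + #|T| <= #|nbhd X|) ->
  tree T -> max_degree T <= d -> contains_copy G T.
Proof.
move=> /card_gt0P[v0 _] m0 small big treeT degT.
have [/card_gt0P[r _] _] := treeT.1.
have grow k : k < #|T| -> exists (S : {set T}) (f : T -> G) (b : G -> nat),
    [/\ #|S| = k.+1, r \in S & embeds_part d m r S f b].
  elim: k => [_|k IH ltk].
    exists [set r], (fun=> v0), (fun=> d); rewrite cards1 set11; split=> //.
    split.
    - by move=> x /set1P ->.
    - by move=> x y /set1P -> /set1P ->.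
    - by move=> x y /set1P -> /set1P ->; rewrite edge_irrefl.
    - move=> X Xm; rewrite sum_nat_const.
      case: (posnP #|X|) => [->//|X0].
      have := small X; rewrite X0 Xm => /(_ isT).
      have -> : [set v0 | _ in [set r]] = [set v0] by rewrite imset_set1.
      by have := cardsD1 v0 (nbhd X); lia.
    - split=> // s _; exact: leq_addr.
  have [S [f [b [cardS rS emb]]]] := IH (ltnW ltk).
  have SnT : S != setT.
    by apply: contraTneq ltk => ST; rewrite -cardsT -ST cardS ltnn.
  have [t [f' [b' [tS emb']]]] :=
    embeds_part_extend m0 big treeT degT rS SnT emb.
  exists (t |: S), f', b'; rewrite cardsU1 tS cardS; split=> //.
  by rewrite in_setU1 rS orbT.
have T0 : 0 < #|T| by case: treeT => -[].
have [|S [f [b [cardS _ [_ inj hom _ _]]]]] := grow #|T|.-1.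
  by rewrite prednK.
have ST : S = setT.
  by apply/eqP; rewrite eqEcard subsetT cardsT cardS prednK /=.
exists f; split.
  by move=> x y; apply: inj; rewrite ST inE.
by move=> x y; apply: hom; rewrite ST inE.
Qed.

Local Open Scope ring_scope.

(** * Spectral theory of real symmetric matrices *)

Lemma count_flatten_nseq (T : eqType) (k : T -> nat) (s : seq T) (x : T) :
  uniq s ->
  count_mem x (flatten [seq nseq (k y) y | y <- s]) =
  if x \in s then k x else 0%N.
Proof.
elim: s => //= y s IH /andP[ys us].
rewrite count_cat count_nseq IH // in_cons /= (eq_sym y).
have [->|_] /= := eqVneq x y; last by rewrite mul0n.
by rewrite (negPf ys) mul1n addn0.
Qed.

(** Both lists contain every root of the characteristic polynomial with its
    multiplicity. *)
Lemma perm_eigenvalues (R : realType) (n : nat) (A : 'M[R]_n) (s : seq R) :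
  char_poly A = \prod_(x <- s) ('X - x%:P) -> perm_eq (eigenvalues A) s.
Proof.
move=> chA; apply/permP => a; rewrite /eigenvalues count_rev.
move: a; apply/permP; rewrite /perm_eq; apply/allP => x _ /=; apply/eqP.
have ch0 : char_poly A != 0 by apply: monic_neq0; apply: char_poly_monic.
rewrite (count_flatten_nseq (fun y => mup y (char_poly A))); last first.
  exact/(sorted_uniq lt_trans lt_irreflexive)/sorted_roots.
rewrite -(roots_on_rootsR ch0) /= chA mu_prod_XsubC.
by rewrite root_prod_XsubC; case: ifP => // /count_memPn.
Qed.

Lemma char_poly_similar (F : fieldType) (n : nat) (P B : 'M[F]_n) :
  P \in unitmx -> char_poly (invmx P *m B *m P) = char_poly B.
Proof.
move=> Pu; rewrite /char_poly /char_poly_mx.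
have -> : 'X%:M - map_mx polyC (invmx P *m B *m P) =
    map_mx polyC (invmx P) *m ('X%:M - map_mx polyC B) *m map_mx polyC P.
  rewrite mulmxBr mulmxBl -!map_mxM; congr (_ - _).
  by rewrite -mulmxA mul_scalar_mx -scalemxAr -map_mxM mulVmx //
     map_mx1 scalemx1.
rewrite !det_mulmx mulrAC -det_mulmx -map_mxM mulVmx // map_mx1 det1 mul1r //.
Qed.

Local Open Scope sesquilinear_scope.

Lemma symmetric_spectral (R : rcfType) (n : nat) (A : 'M[R]_n) :
  A^T = A ->
  exists (P : 'M[R[i]%C]_n) (r : 'I_n -> R),
    [/\ P \is unitarymx,
        map_mx (real_complex R) A =
          P^t* *m diag_mx (\row_i (r i)%:C%C) *m P &
        char_poly A = \prod_i ('X - (r i)%:P)].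
Proof.
move=> symA; pose B := map_mx (real_complex R) A.
have Breal : B \is a mxOver Num.real.
  by apply/mxOverP => i j; rewrite mxE; apply/complex_realP; exists (A i j).
have Bherm : B \is hermsymmx.
  apply: realsym_hermsym => //; apply/is_hermitianmxP.
  by rewrite expr0 scale1r; apply/matrixP => i j; rewrite !mxE -{1}symA mxE.
have Uu := spectral_unitarymx B.
have /orthomx_spectralP Beq := hermitian_normalmx Bherm.
pose r i := complex.Re (spectral_diag B 0 i).
have rE : spectral_diag B = \row_i (r i)%:C%C.
  apply/rowP => i; rewrite mxE RRe_real //.
  exact: (mxOverP (hermitian_spectral_diag_real Bherm)).
exists (spectralmx B), r; split=> //.
  by rewrite -rE -(invmx_unitary Uu); apply: Beq.
apply: (map_poly_inj (real_complex R)).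
rewrite map_char_poly -/B Beq char_poly_similar ?unitarymx_unit //.
rewrite char_poly_trig ?diag_mx_is_trig // rmorph_prod /=.
apply: eq_bigr => i _; rewrite rmorphB /= map_polyX map_polyC /=.
by rewrite rE !mxE eqxx mulr1n.
Qed.

Lemma unitary_parseval (C : numClosedFieldType) (n : nat) (P : 'M[C]_n)
    (x y : 'rV[C]_n) :
  P \is unitarymx ->
  \sum_j (x *m P^t*) 0 j * ((y *m P^t*) 0 j)^* = \sum_j x 0 j * (y 0 j)^*.
Proof.
move=> Pu.
have dot (a b : 'rV[C]_n) : \sum_j a 0 j * (b 0 j)^* = (a *m b^t*) 0 0.
  by rewrite mxE; apply: eq_bigr => j _; rewrite !mxE.
rewrite !dot trmx_mul map_mxM trmxCK mulmxA.
have PP : P^t* *m P = 1%:M.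
  by rewrite -invmx_unitary // mulVmx // unitarymx_unit.
by rewrite -(mulmxA x) PP mulmx1.
Qed.

(** In an orthonormal eigenbasis, [mu] occurs among the eigenvalues, and since
    it exceeds the bound on all but the first of them it is the first and
    simple.  So [u] has a single nonzero coordinate, the corresponding
    coordinate of [x] vanishes, and all the others are multiplied by numbers
    of absolute value at most [lam]. *)
Lemma norm_off_top_eigenvector (R : realType) (n : nat) (A : 'M[R]_n)
    (mu lam : R) (u x : 'rV[R]_n) :
  A^T = A -> u *m A = mu *: u -> u != 0 -> lam < mu ->
  (forall i, (1 <= i < n)%N -> `|(eigenvalues A)`_i| <= lam) ->
  \sum_j x 0 j * u 0 j = 0 ->
  \sum_j (x *m A) 0 j ^+ 2 <= lam ^+ 2 * \sum_j x 0 j ^+ 2.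
Proof.
move=> symA uA u0 lammu eigs xu.
have [P [r [Pu AE chA]]] := symmetric_spectral symA.
pose toC := map_mx (real_complex R) : 'rV[R]_n -> 'rV[R[i]%C]_n.
pose co (z : 'rV[R]_n) := toC z *m P^t*.
have realC (a : R) : (a%:C%C)^* = a%:C%C :> R[i]%C.
  by apply/CrealP/complex_realP; exists a.
have dotE (y z : 'rV[R]_n) :
    (\sum_j y 0 j * z 0 j)%:C%C = \sum_j co y 0 j * (co z 0 j)^*.
  rewrite unitary_parseval // rmorph_sum /=; apply: eq_bigr => j _.
  by rewrite !mxE realC rmorphM.
have coA z j : co (z *m A) 0 j = (r j)%:C%C * co z 0 j.
  rewrite /co /toC map_mxM AE !mulmxA mulmxtVK //.
  by rewrite mul_mx_diag !mxE mulrC.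
have cou j : (r j)%:C%C * co u 0 j = mu%:C%C * co u 0 j.
  by rewrite -coA uA /co /toC map_mxZ -scalemxAl mxE.
have [i0 ui0] : exists i0, co u 0 i0 != 0.
  apply/existsP; apply: contraNT u0; rewrite negb_exists => /forallP all0.
  have cou0 : co u = 0.
    apply/rowP => j; rewrite [RHS]mxE; apply/eqP.
    by have := all0 j; rewrite negbK.
  have : toC u = 0.
    have := congr1 (mulmx^~ P) cou0; rewrite /co mul0mx -mulmxA.
    by rewrite -invmx_unitary // mulVmx ?unitarymx_unit // mulmx1.
  move/rowP => toC0; apply/eqP/rowP => j; have := toC0 j; rewrite !mxE.
  by case.
have ri0 : r i0 = mu.
  by apply: (@complexI R); apply: (mulIf ui0); apply: cou.
have permr : perm_eq (eigenvalues A) (map r (enum 'I_n)).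
  apply: perm_eigenvalues; rewrite chA big_map big_enum /=.
  by apply: eq_bigl.
have sizeE : size (eigenvalues A) = n.
  by rewrite (perm_size permr) size_map size_enum_ord.
(* Since mu > lam, the head of the list of eigenvalues is mu; removing it on
   both sides of the permutation leaves the other diagonal entries. *)
have rother j : j != i0 -> `|r j| <= lam.
  move=> ji0; have nth_in : mu \in eigenvalues A.
    by rewrite (perm_mem permr) -ri0 map_f // mem_enum.
  move: permr sizeE eigs;
  case: (eigenvalues A) nth_in => // a l mul permr sz eigs.
  have lsmall b : b \in l -> `|b| <= lam.
    move=> bl; have := eigs (index b l).+1; rewrite /= -sz /= ltnS index_mem bl.
    by rewrite nth_index // => /(_ isT).
  have amu : a = mu.
    move: mul; rewrite in_cons => /orP[/eqP -> //|/lsmall].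
    by move=> /(le_trans (ler_norm _)); rewrite leNgt lammu.
  have pe : perm_eq (a :: l) (r i0 :: map r (rem i0 (enum 'I_n))).
    apply: perm_trans permr _; rewrite -map_cons; apply: perm_map.
    by apply: perm_to_rem; rewrite mem_enum.
  rewrite amu ri0 perm_cons in pe.
  apply: lsmall; rewrite (perm_mem pe) map_f //.
  by rewrite mem_rem_uniq ?enum_uniq // inE ji0 mem_enum.
have uother j : j != i0 -> co u 0 j = 0.
  move=> ji0; have /eqP := cou j; rewrite -subr_eq0 -mulrBl mulf_eq0.
  rewrite -rmorphB /= => /orP[|/eqP //]; rewrite fmorph_eq0 subr_eq0 => /eqP rj.
  have := rother j ji0; rewrite rj => /(le_trans (ler_norm _)).
  by rewrite leNgt lammu.
have xi0 : co x 0 i0 = 0.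
  have := dotE x u; rewrite xu (bigD1 i0) //= big1 ?addr0; last first.
    by move=> j ji0; rewrite uother // conjC0 mulr0.
  move/esym/eqP; rewrite mulf_eq0 conjC_eq0 (negPf ui0) orbF.
  by move/eqP.
rewrite -lecR rmorphM /= (eq_bigr _ (fun j _ => expr2 _)) dotE.
rewrite [in leRHS](eq_bigr _ (fun j _ => expr2 _)) dotE mulr_sumr.
apply: ler_sum => j _; rewrite !coA -!normCK normrM exprMn.
have [->|ji0] := eqVneq j i0; first by rewrite xi0 normr0 expr0n /= !mulr0.
apply: ler_wpM2r; first exact: exprn_ge0.
rewrite real_normK; last by apply/complex_realP; exists (r j).
rewrite -rmorphXn /= lecR -(real_normK (num_real (r j))).
have := rother j ji0; have := normr_ge0 (r j); nra.
Qed.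

Local Close Scope sesquilinear_scope.

(** * Expansion of graphs with a spectral gap *)

(** Nonnegativity of the variance of [c] over [N]. *)
Lemma sqr_sum_le_card (R : realFieldType) (I : finType) (N : {set I})
    (c : I -> R) :
  (\sum_(i in N) c i) ^+ 2 <= #|N|%:R * \sum_(i in N) c i ^+ 2.
Proof.
set S := \sum_(i in N) c i; set Q := \sum_(i in N) c i ^+ 2.
have [/eqP|N0] := posnP #|N|.
  rewrite cards_eq0 => /eqP N0; rewrite /S /Q N0 !big_set0 cards0.
  by rewrite expr0n mul0r.
have Nr : 0 < #|N|%:R :> R by rewrite ltr0n.
have : 0 <= \sum_(i in N) (#|N|%:R * c i - S) ^+ 2.
  by apply: sumr_ge0 => i _; apply: sqr_ge0.
rewrite (eq_bigr (fun i =>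
    #|N|%:R ^+ 2 * c i ^+ 2 - 2 * #|N|%:R * S * c i + S ^+ 2));
  last by move=> i _; ring.
rewrite big_split sumrB -!mulr_sumr /= sumr_const.
rewrite -(mulr_natl S) -/S -/Q.
have -> : #|N|%:R ^+ 2 * Q - 2 * #|N|%:R * S * S + S * (#|N|%:R * S) =
   #|N|%:R * (#|N|%:R * Q - S ^+ 2) by ring.
by rewrite pmulr_rge0 // subr_ge0.
Qed.

Lemma adjmx_sym (R : realType) (G : sgraph) : (adjmx R G)^T = adjmx R G.
Proof. by apply/matrixP => i j; rewrite !mxE edge_sym. Qed.

Lemma second_eigenvalueP (R : realType) (G : sgraph) (lam : R) (i : nat) :
  second_eigenvalue R G <= lam -> (1 <= i < #|G|)%N ->
  `|(eigenvalues (adjmx R G))`_i| <= lam.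
Proof.
move=> le_lam i_in; apply: le_trans le_lam; rewrite /second_eigenvalue.
have := @Order.TotalTheory.le_bigmax_seq _ R nat (index_iota 1 #|G|) 0 i predT
  (fun j => `|(eigenvalues (adjmx R G))`_j|).
by apply; rewrite ?mem_index_iota.
Qed.

(** Let [c] count the neighbours in [X].  It is supported on [nbhd X] and sums
    to [D |X|], so its squared norm is at least [(D |X|)^2 / |nbhd X|].  On the
    other hand [c] is the image under the adjacency matrix of the indicator
    of [X], whose constant part contributes [D^2 |X|^2 / n] and whose part
    orthogonal to the constants contributes at most [lam^2 |X|]. *)
Lemma tanner (R : realType) (n D : nat) (lam : R) (G : sgraph) (X : {set G}) :
  ndl_graph n D lam G -> lam < D%:R ->
  D%:R ^+ 2 * #|X|%:R * n%:R <=
    #|nbhd X|%:R * (lam ^+ 2 * n%:R + D%:R ^+ 2 * #|X|%:R).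
Proof.
case=> cardG reg lamG lamD; set Dr : R := D%:R; set nr : R := n%:R.
set k : R := #|X|%:R; set N : R := #|nbhd X|%:R.
have [X0|Xpos] := posnP #|X|.
  by rewrite /k X0 !(mulr0, mul0r, addr0) mulr_ge0 // mulr_ge0 // sqr_ge0.
have npos : (0 < n)%N by rewrite -cardG; apply: leq_trans Xpos (max_card _).
have k0 : 0 < k by rewrite ltr0n.
have n0 : 0 < nr by rewrite ltr0n.
pose c (y : G) : R := \sum_(x in X) (edge x y)%:R.
have sumdeg (x : G) : \sum_y (edge x y)%:R = Dr.
  rewrite -natr_sum /Dr -(reg x) /degree -sum1_card [in RHS]big_mkcond /=.
  by congr (_%:R); apply: eq_bigr => y _; rewrite inE; case: edge.
have sumc : \sum_y c y = Dr * k.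
  rewrite exchange_big /= (eq_bigr (fun=> Dr)) => [|x _]; last exact: sumdeg.
  by rewrite sumr_const mulr_natr.
have c_out y : y \notin nbhd X -> c y = 0.
  move=> yN; apply: big1 => x xX; case: (boolP (edge x y)) => // exy.
  by case/negP: yN; apply/nbhdP; exists x.
have sum_on (F : R -> R) : F 0 = 0 ->
    \sum_(y in nbhd X) F (c y) = \sum_y F (c y).
  move=> F0; rewrite big_mkcond /=; apply: eq_bigr => y _.
  by case: ifPn => // /c_out ->.
have CS : (Dr * k) ^+ 2 <= N * \sum_y c y ^+ 2.
  have := sqr_sum_le_card (nbhd X) c.
  by rewrite (sum_on id) // (sum_on (fun z => z ^+ 2)) ?expr0n // sumc.
have enumE (F : G -> R) : \sum_(i < #|G|) F (enum_val i) = \sum_y F y.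
  by rewrite -big_enum_val.
have cst (a : R) : \sum_(y : G) a = a * nr.
  by rewrite sumr_const cardG mulr_natr.
pose u : 'rV[R]_#|G| := const_mx 1.
have uA : u *m adjmx R G = Dr *: u.
  apply/rowP => j; rewrite !mxE mulr1 -(sumdeg (enum_val j)) -enumE.
  by apply: eq_bigr => i _; rewrite !mxE mul1r edge_sym.
have u0 : u != 0.
  have i : 'I_#|G| by rewrite cardG; exists 0%N.
  by apply/eqP => /rowP/(_ i); rewrite !mxE => /eqP; rewrite oner_eq0.
(* x is the indicator of X projected orthogonally to the constants. *)
pose a := k / nr.
pose x : 'rV[R]_#|G| := \row_j ((enum_val j \in X)%:R - a).
have sumX : \sum_y (y \in X)%:R = k :> R.
  by rewrite -natr_sum /k -sum1_card [in RHS]big_mkcond /=; congr (_%:R);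
     apply: eq_bigr => y _; case: (y \in X).
have xu : \sum_j x 0 j * u 0 j = 0.
  rewrite (eq_bigr (fun j => (enum_val j \in X)%:R - a)).
    by rewrite (enumE (fun y => (y \in X)%:R - a)) sumrB cst sumX /a divfK
       ?gt_eqF // subrr.
  by move=> j _; rewrite !mxE mulr1.
have xA j : (x *m adjmx R G) 0 j = c (enum_val j) - a * Dr.
  rewrite mxE (eq_bigr (fun i =>
    (enum_val i \in X)%:R * (edge (enum_val i) (enum_val j))%:R -
    a * (edge (enum_val j) (enum_val i))%:R)); last first.
    by move=> i _; rewrite !mxE mulrBl [in X in _ - X]edge_sym.
  rewrite sumrB -mulr_sumr (enumE (fun y => (edge (enum_val j) y)%:R)) sumdeg.
  congr (_ - _).
  rewrite (enumE (fun y => (y \in X)%:R * (edge y (enum_val j))%:R)).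
  rewrite /c [RHS]big_mkcond /=; apply: eq_bigr => y _.
  by case: (y \in X); rewrite ?mul1r ?mul0r.
have := norm_off_top_eigenvector (adjmx_sym R G) uA u0 lamD
  (fun i => second_eigenvalueP lamG) xu.
rewrite (eq_bigr _ (fun j _ => congr1 (fun z => z ^+ 2) (xA j))).
rewrite (enumE (fun y => (c y - a * Dr) ^+ 2)).
rewrite (eq_bigr (fun y => c y ^+ 2 - 2 * (a * Dr) * c y + (a * Dr) ^+ 2));
  last by move=> y _; ring.
rewrite big_split sumrB -mulr_sumr sumc cst /=.
have -> : \sum_j x 0 j ^+ 2 = k - a * k.
  rewrite (eq_bigr (fun j => ((enum_val j \in X)%:R - a) ^+ 2)); last first.
    by move=> j _; rewrite mxE.
  rewrite (enumE (fun y => ((y \in X)%:R - a) ^+ 2)).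
  rewrite (eq_bigr (fun y => (1 - 2 * a) * (y \in X)%:R + a ^+ 2)); last first.
    by move=> y _; case: (y \in X) => /=; ring.
  rewrite big_split -mulr_sumr sumX cst /= /a; field; exact: lt0r_neq0.
have ka : k = a * nr by rewrite /a divfK // gt_eqF.
set Q := \sum_y c y ^+ 2 in CS *.
have a0 : 0 < a by rewrite divr_gt0.
have N0 : 0 <= N by exact: ler0n.
move=> specQ.
have Qle : Q <= lam ^+ 2 * k + Dr ^+ 2 * k * a.
  have : lam ^+ 2 * (k - a * k) <= lam ^+ 2 * k.
    by apply: ler_wpM2l; [exact: sqr_ge0 | nra].
  move: specQ; rewrite ka; nra.
have step : (Dr * k) ^+ 2 <= N * (lam ^+ 2 * k + Dr ^+ 2 * k * a).
  by apply: le_trans CS _; apply: ler_wpM2l.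
have -> : Dr ^+ 2 * k * nr = (Dr * k) ^+ 2 / a.
  by rewrite ka; field; exact: lt0r_neq0.
rewrite ler_pdivrMr //; apply: le_trans step _.
by rewrite le_eqVlt; apply/orP; left; apply/eqP; rewrite ka; ring.
Qed.

(** The choice [m = floor (eps n / (4 d))] balances the two requirements: a set
    of at most [2 m] vertices has demand at most [eps n / 2], while a set of
    more than [m] vertices has at least [(1 - eps / 4) n] neighbours. *)
Theorem spectral_expander_contains_tree (R : realType) (d n D : nat)
    (eps lam : R) (G T : sgraph) :
  (0 < d)%N -> 0 < eps -> eps <= 1 -> 0 < lam -> ndl_graph n D lam G ->
  4 * d%:R / eps <= D%:R / lam ->
  tree T -> #|T|%:R <= (1 - eps) * n%:R -> (max_degree T <= d)%N ->
  contains_copy G T.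
Proof.
move=> d0 eps0 eps1 lam0 hG hK treeT cardT degT.
have cardG : #|G| = n by case: hG.
set K := D%:R / lam in hK.
have dr1 : 1 <= d%:R :> R by rewrite ler1n.
have epsK : 4 * d%:R <= eps * K by rewrite [eps * K]mulrC -ler_pdivrMr.
have K0 : 0 < K by rewrite -(pmulr_rgt0 _ eps0); lra.
have K4 : 4 * d%:R <= K by apply: le_trans epsK _; rewrite ger_pMl.
have lamD : lam < D%:R.
  by rewrite -[ltLHS]mul1r -ltr_pdivlMr // -/K; lra.
have T1 : (0 < #|T|)%N by case: treeT => -[].
have n0 : (0 < n)%N.
  rewrite lt0n; apply: contraTneq cardT => ->; rewrite mulr0 -ltNge ltr0n //.
have nr0 : 0 < n%:R :> R by rewrite ltr0n.
have tannerK (X : {set G}) :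
    K ^+ 2 * #|X|%:R * n%:R <= #|nbhd X|%:R * (n%:R + K ^+ 2 * #|X|%:R).
  have := tanner X hG lamD.
  have -> : D%:R = K * lam by rewrite /K divfK ?gt_eqF.
  set k := #|X|%:R; set N := #|nbhd X|%:R => tan.
  rewrite -(ler_pM2l (exprn_gt0 2 lam0)).
  have -> : lam ^+ 2 * (K ^+ 2 * k * n%:R) = (K * lam) ^+ 2 * k * n%:R by ring.
  by apply: le_trans tan _; rewrite le_eqVlt; apply/orP; left; apply/eqP; ring.
have G0 : (0 < #|G|)%N by rewrite cardG.
(* Tanner's inequality for a single vertex, which is not its own neighbour;
   this bound guarantees that m is positive. *)
have Kn : K <= n%:R.
  have [v _] := card_gt0P G0.
  have := tannerK [set v]; rewrite cards1.
  have : #|nbhd [set v]|%:R <= n%:R - 1 :> R.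
    have : (#|nbhd [set v]| < n)%N.
      rewrite -cardG -cardsT; apply: proper_card; apply/properP; split.
        exact: subsetT.
      exists v; first by rewrite inE.
      apply/negP => /nbhdP[x /set1P ->].
      by rewrite edge_irrefl.
    by rewrite -(ler_nat R) -addn1 natrD; lra.
  set N := #|_|%:R; move=> Nn tan.
  have N0 : 0 <= N by exact: ler0n.
  rewrite leNgt; apply/negP => nK; nra.
pose z : R := eps * n%:R / (4 * d%:R).
have zE : 4 * d%:R * z = eps * n%:R by rewrite /z mulrC divfK //; lra.
have z0 : 0 <= z by rewrite divr_ge0 // ?mulr_ge0 //; lra.
pose m := Num.truncn z.
have /andP[mz zm] := truncn_itv z0.
have z1 : 1 <= z.
  have : eps * K <= eps * n%:R by rewrite ler_pM2l.
  rewrite -zE => h; have : 4 * d%:R * 1 <= 4 * d%:R * z by lra.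
  by rewrite ler_pM2l //; lra.
have m0 : (0 < m)%N.
  by rewrite truncn_gt0.
apply: (@expander_contains_tree G T d m) => //.
- move=> X /andP[X0 Xm].
  rewrite ltnNge; apply/negP => small.
  have := tannerK X; move: small; rewrite -(ler_nat R) natrM.
  have : #|X|%:R <= z by apply: le_trans mz; rewrite ler_nat.
  have : 1 <= #|X|%:R :> R by rewrite ler1n.
  set k := #|X|%:R; set N := #|nbhd X|%:R => k1 kz Nk tan.
  have dk : 4 * (d%:R * k) <= n%:R.
    have : 4 * d%:R * k <= 4 * d%:R * z by apply: ler_wpM2l => //; lra.
    rewrite zE; have : eps * n%:R <= n%:R by rewrite ger_pMl.
    lra.
  have K2 : 16 * d%:R <= K ^+ 2 by nra.
  have pos : 0 <= n%:R + K ^+ 2 * k by nra.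
  have : K ^+ 2 * k * n%:R <= d%:R * k * (n%:R + K ^+ 2 * k).
    by apply: le_trans tan _; apply: ler_wpM2r.
  have : 4 * (d%:R * k * (K ^+ 2 * k)) <= n%:R * (K ^+ 2 * k).
    have : 0 <= K ^+ 2 * k by nra.
    nra.
  have : 16 * d%:R * (k * n%:R) <= K ^+ 2 * (k * n%:R).
    by apply: ler_wpM2r => //; nra.
  have : 0 < d%:R * (k * n%:R) by apply: mulr_gt0; nra.
  nra.
- move=> X /andP[mX X2m].
  rewrite -(ler_nat R) natrD natrM.
  have := tannerK X.
  have : z <= #|X|%:R.
    by apply: (le_trans (ltW zm)); rewrite ler_nat.
  have : #|X|%:R <= 2 * z.
    apply: (@le_trans _ _ (m.*2)%:R); first by rewrite ler_nat.
    by rewrite -mul2n natrM; lra.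
  have : #|nbhd X|%:R <= n%:R :> R by rewrite ler_nat -cardG max_card.
  set k := #|X|%:R; set N := #|nbhd X|%:R => Nn k2z zk tan.
  have dk : d%:R * k <= eps * n%:R / 2.
    have : d%:R * k <= d%:R * (2 * z) by apply: ler_wpM2l => //; lra.
    lra.
  (* Tanner's inequality, with the vertices outside N(X) on the left. *)
  have missing : K ^+ 2 * k * (n%:R - N) <= n%:R * n%:R by nra.
  have : K ^+ 2 * z * (n%:R - N) <= n%:R * n%:R.
    apply: le_trans missing; apply: ler_wpM2r; first lra.
    by apply: ler_wpM2l => //; apply: sqr_ge0.
  move=> h1.
  have h2 : eps * K ^+ 2 * (n%:R - N) <= 4 * d%:R * n%:R.
    rewrite -(ler_pM2r nr0).
    have : 4 * d%:R * (K ^+ 2 * z * (n%:R - N)) <= 4 * d%:R * (n%:R * n%:R).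
      by apply: ler_wpM2l => //; lra.
    have -> : 4 * d%:R * (K ^+ 2 * z * (n%:R - N)) =
      (4 * d%:R * z) * K ^+ 2 * (n%:R - N) by ring.
    rewrite zE; lra.
  have h3 : K * (n%:R - N) <= n%:R.
    rewrite -(@ler_pM2l _ (4 * d%:R)); last lra.
    apply: le_trans h2.
    have : 4 * d%:R * (K * (n%:R - N)) <= eps * K * (K * (n%:R - N)).
      by apply: ler_wpM2r => //; apply: mulr_ge0; lra.
    lra.
  have h4 : 4 * (n%:R - N) <= eps * n%:R.
    have : eps * (K * (n%:R - N)) <= eps * n%:R by rewrite ler_pM2l.
    have : 4 * 1 * (n%:R - N) <= eps * K * (n%:R - N).
      by apply: ler_wpM2r; lra.
    lra.
  lra.
Qed.

(** The hypothesis gives [4 d / eps <= D / lambda], because [d^(5/2) >= d] and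
    [log (2 / eps) >= 1 - eps / 2 >= 3 / 4]. *)
Theorem theorem1p2 (R : realType) (d n D : nat) (eps lambda : R) (G : sgraph)
    (hd : (2 <= d)%N) (heps0 : 0 < eps) (heps1 : eps < 1 / 2)
    (hG : ndl_graph n D lambda G) (hlambda : 0 < lambda)
    (hDlambda :
      D%:R / lambda >= 160 * d%:R `^ (5 / 2) * ln (2 / eps) / eps)
    (T : sgraph) (hT : tree T)
    (hTn : #|T|%:Z = Num.floor ((1 - eps) * n%:R))
    (hTd : (max_degree T <= d)%N) :
  contains_copy G T.
Proof.
have d1 : 1 <= d%:R :> R by rewrite ler1n (ltnW hd).
apply: (@spectral_expander_contains_tree R d n D eps lambda) => //.
- exact: ltnW.
- lra.
- apply: le_trans hDlambda; rewrite ler_pM2r ?invr_gt0 //.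
  have powd : d%:R <= d%:R `^ (5 / 2) :> R.
    rewrite -[leLHS]powRr1; last lra.
    by apply: ler_powR => //; lra.
  have log34 : 3 / 4 <= ln (2 / eps).
    have : ln (eps / 2) <= eps / 2 - 1.
      have := @le_ln1Dx R (eps / 2 - 1); rewrite [1 + _]addrC subrK; apply; lra.
    rewrite -[2 / eps]invf_div lnV ?posrE ?divr_gt0 //; lra.
  nra.
- have := floor_le ((1 - eps) * n%:R).
  by rewrite -hTn.
Qed.
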